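(* Let $\varphi_1:(\mathbb{R}^n,0)\to(\mathbb{R}^n,0)$ be an involution, let $F:(\mathbb{R}^n,0)\to(\mathbb{R}^n,0)$ be a $\varphi_1$-reversible germ of diffeomorphism, and put $\varphi_2=\varphi_1\circ F$ (so $\varphi_2$ is an involution and $F=\varphi_1\circ\varphi_2$). For any reversing symmetry $\varphi$ of $F$, if $x\in\mathrm{Fix}(\varphi)$ and there exists an integer $\ell\ge1$ such that $F^\ell(x)\in\mathrm{Fix}(\varphi)$, then the $F$-orbit of $x$ is periodic. In addition, let $\varphi_k=\varphi_2\circ F^{k-2}$ and $\varphi_k'=F^{k-1}\circ\varphi_1$ for integers $k\ge1$. For integers $\ell>k\ge1$: (A) If $x\in\mathrm{Fix}(\varphi_k)\cap\mathrm{Fix}(\varphi_\ell)$, then the orbit of $x$ is a periodic orbit with period that divides $\ell-k$. Also, if $x$ is a periodic point with period that divides $\ell-k$ and $x\in\mathrm{Fix}(\varphi_k)$, then $x\in\mathrm{Fix}(\varphi_\ell)$. (B) If $x\in\mathrm{Fix}(\varphi_k')\cap\mathrm{Fix}(\varphi_\ell')$, then the orbit of $x$ is a periodic orbit with period that divides $\ell-k$. Also, if $x$ is a periodic point with period that divides $\ell-k$ and $x\in\mathrm{Fix}(\varphi_k')$, then $x\in\mathrm{Fix}(\varphi_\ell')$. (C) If $x\in\mathrm{Fix}(\varphi_k')\cap\mathrm{Fix}(\varphi_\ell)$, then the orbit of $x$ is a periodic orbit with period that divides $k+\ell-2$. Also, if $x$ is a periodic point with period that divides $k+\ell-2$ and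 $x\in\mathrm{Fix}(\varphi_k')$, then $x\in\mathrm{Fix}(\varphi_\ell)$.
   Context: All maps are germs at $0\in\mathbb{R}^n$ of maps fixing $0$; points $x\in(\mathbb{R}^n,0)$ are points near $0$ at which the iterates and compositions involved are defined. $I_n$ is the germ of the identity. An involution is a germ of a diffeomorphism $\varphi:(\mathbb{R}^n,0)\to(\mathbb{R}^n,0)$ with $\varphi\circ\varphi=I_n$. For an invertible map germ $\varphi:(\mathbb{R}^n,0)\to(\mathbb{R}^n,0)$, a germ of diffeomorphism $F$ is $\varphi$-reversible, and $\varphi$ is a reversing symmetry of $F$, if $F\circ\varphi=\varphi\circ F^{-1}$. $\mathrm{Fix}(\varphi)=\{x\in(\mathbb{R}^n,0):\varphi(x)=x\}$. The $F$-orbit of $x$ is the ordered set $\{F^k(x):k\in\mathbb{Z}\}$; it is periodic if $F^m(x)=x$ for some integer $m\ge1$, and the period is the least such $m$. The formulas for $\varphi_k$ and $\varphi_k'$ are consistent for $k=1,2$, with $\varphi_1'=\varphi_1$, and all $\varphi_k,\varphi_k'$ are reversing symmetries of $F$. *)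

(* Defs.v *)
From HB Require Import structures.
From mathcomp Require Import all_boot all_order all_algebra.
From mathcomp Require Import all_classical all_reals all_analysis.
Set Implicit Arguments.
Unset Strict Implicit.
Unset Printing Implicit Defensive.
Import Order.TTheory GRing.Theory Num.Theory.
Import numFieldNormedType.Exports.
Local Open Scope classical_set_scope.
Local Open Scope ring_scope.

(* Germs of invertible maps are handled through representatives: a
   representative is a partial bijection, i.e. an injective partial map
   ([None] = undefined) packaged with its (uniquely determined) partial inverse.
   Compositions and iterates are compositions of partial maps, so that
   "[f x = Some y]" always means "[f] is defined at [x], with value [y]". *)
Record pbij (V : Type) := PBij {
  pfun :> V -> option V;
  pinv : V -> option V;
  pinvP : forall x y, pfun x = Some y <-> pinv y = Some x }.

Section PartialBijections.
Variable V : Type.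
Implicit Types f g : pbij V.

Definition pdom (f : V -> option V) : set V := [set x | isSome (f x)].

Lemma pbid_subproof (x y : V) : Some x = Some y <-> Some y = Some x.
Proof. by split=> ->. Qed.

Definition pbid : pbij V := PBij pbid_subproof.

Lemma pbinv_subproof f x y : pinv f x = Some y <-> f y = Some x.
Proof. by split=> /pinvP. Qed.

Definition pbinv f : pbij V := PBij (pbinv_subproof f).

Lemma pbcomp_subproof f g x y :
  obind f (g x) = Some y <-> obind (pinv g) (pinv f y) = Some x.
Proof.
split.
- by case E: (g x) => [z|] //= /pinvP ->; apply/pinvP.
- by case E: (pinv f y) => [z|] //= /pinvP -> /=; apply/pinvP.
Qed.

Definition pbcomp f g : pbij V := PBij (pbcomp_subproof f g).

Definition pbpow f (k : int) : pbij V :=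
  match k with
  | Posz m => iter m (pbcomp f) pbid
  | Negz m => iter m.+1 (pbcomp (pbinv f)) pbid
  end.

Definition Fixp f : set V := [set x | f x = Some x].

Definition periodic_orbit f (x : V) : Prop :=
  exists m : nat, (1 <= m)%N /\ pbpow f m x = Some x.

Definition has_period f (x : V) (m : nat) : Prop :=
  [/\ (1 <= m)%N, pbpow f m x = Some x &
      forall j : nat, (1 <= j)%N -> pbpow f j x = Some x -> (m <= j)%N].

Definition periodic_orbit_dvd f (x : V) (N : nat) : Prop :=
  exists2 m : nat, has_period f x m & (m %| N)%N.

End PartialBijections.

Section Germs.
Variables (R : realType) (n : nat).
Let V := 'rV[R]_n.
Implicit Types f g : pbij V.

(* Equality of the germs at 0. *)
Definition germ_eq f g : Prop := \forall x \near (0 : V), f x = g x.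

(* [f] is of class C^k on the open set [U]: in finite dimension, C^(k+1) means
   differentiable with all directional derivatives of class C^k. *)
Fixpoint Ck_on (k : nat) (U : set V) (f : V -> V) : Prop :=
  match k with
  | 0 => forall x, U x -> {for x, continuous f}
  | k'.+1 => (forall x, U x -> differentiable f x) /\
             (forall v : V, Ck_on k' U (fun x => 'D_v f x))
  end.

(* The value 0 outside the open domain is irrelevant: continuity and
   derivatives are only considered at points of the domain. *)
Definition ptotal (f : V -> option V) : V -> V := fun x => odflt 0 (f x).

Definition smooth (f : V -> option V) : Prop :=
  forall k, Ck_on k (pdom f) (ptotal f).

(* An invertible map germ (R^n, 0) -> (R^n, 0): a homeomorphism between open
   neighbourhoods of 0 which fixes 0. *)
Definition local_homeo f : Prop :=
  [/\ f 0 = Some 0,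
      open (pdom f) /\ open (pdom (pinv f)),
      forall x, pdom f x -> {for x, continuous (ptotal f)} &
      forall x, pdom (pinv f) x -> {for x, continuous (ptotal (pinv f))}].

(* Likewise with a C^oo diffeomorphism. *)
Definition local_diffeo f : Prop :=
  [/\ f 0 = Some 0,
      open (pdom f) /\ open (pdom (pinv f)),
      smooth f & smooth (pinv f)].

Definition involution f : Prop :=
  local_diffeo f /\ germ_eq (pbcomp f f) (pbid V).

Definition reversing_symmetry f F : Prop :=
  local_homeo f /\ germ_eq (pbcomp F f) (pbcomp f (pbinv F)).

End Germs.

(* Main.v *)
Require Import Defs.
From HB Require Import structures.
From mathcomp Require Import all_boot all_order all_algebra.
From mathcomp Require Import all_classical all_reals all_analysis.
From mathcomp Require Import zify.
Set Implicit Arguments.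
Unset Strict Implicit.
Unset Printing Implicit Defensive.
Import Order.TTheory GRing.Theory Num.Theory.
Import numFieldNormedType.Exports.
Local Open Scope classical_set_scope.
Local Open Scope ring_scope.

(** Two different kinds of argument meet here.

    The dynamical assertions are word manipulations with injective partial
    maps. A fixed point of a reversing symmetry [psi] satisfies
    [F^j (psi (F^j x)) = psi x = x], because [F \o psi \o F = psi] near 0; if
    [F^l x] is also fixed by [psi], taking [j = l] gives [F^(2l) x = x]
    ([Fixp_reversor_orbit]). For (A)-(C) everything is expressed by
    nonnegative powers of [F]:
    - [x] is fixed by [phi_k] iff [phi1] sends [F^(k-1) x] to [x], where for
      [k = 1] the point [x] must in addition lie in the image of [F]
      ([Fixp_phiP]);
    - [x] is fixed by [phi'_k] iff [x = F^(k-1) (phi1 x)] ([Fixp_phi'P]).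
    In (A), injectivity of [phi1] turns two such conditions into
    [F^(k-1) x = F^(l-1) x]; in (B) they say that [F^(k-1)] and [F^(l-1)] both
    send [phi1 x] to [x]; in (C), [phi1 (phi1 x) = x] gives
    [F^(l-1) x = phi1 x] and [F^(k-1) (phi1 x) = x]. Each time, cancelling
    powers of [F] shows that the second fixed point condition is equivalent
    to [F^N x = x] with [N = l - k] or [N = k + l - 2], that is, to a period
    dividing [N] ([periodic_orbit_dvdP]). Only (C) restricts [x], to the
    neighbourhood of 0 on which [phi1] is its own inverse; a single
    neighbourhood therefore serves all [k] and [l].

    That [phi2 = phi1 \o F] is an involution consists of a germ identity,
    [phi1 \o F \o phi1 \o F = phi1 \o phi1 \o F^-1 \o F], and of the
    smoothness of a composition of partially defined smooth maps. The latter
    rests on [Ck_comp], an induction on [k] from the chain rule written in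
    coordinates, [D_v (g \o f) = \sum_i (D_v f)_i *: (D_(e_i) g \o f)]: the
    right-hand side only involves sums, products and compositions of maps of
    class C^k when [f] and [g] are of class C^(k+1). *)

(** * Differentiability: local nature and the product rule *)

(** Differentiability depends on the germ only: the first order expansion of
    [f] at [x] is also one of [g]. *)
Lemma near_eq_differentiable (K : numFieldType) (V W : normedModType K)
    (f g : V -> W) (x : V) :
  (\near x, f x = g x) -> differentiable f x -> differentiable g x.
Proof.
move=> fg df; have fgx : f x = g x by exact: nbhs_singleton fg.
have expand : g \o shift x = cst (g x) + 'd f x +o_ 0 id.
  apply/eqaddoP => e e0; have /diff_locallyP[_ /eqaddoP/(_ e e0) dfe] := df.
  have fg0 : \forall y \near 0, f (y + x) = g (y + x).
    by rewrite (near_shift x) /= sub0r; near=> z; rewrite /= subrK; near: z.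
  by apply: filterS2 fg0 dfe => y; rewrite !fctE /= -fgx => <-.
apply/diff_locallyP; rewrite (diff_unique (diff_continuous df) expand).
by split=> //; exact: diff_continuous.
Unshelve. all: by end_near. Qed.

Lemma scaler_is_bilinear (K : numFieldType) (V : normedModType K) :
  bilinear_for (GRing.Scale.Law.clone _ _ *:%R _)
    (GRing.Scale.Law.clone _ _ *:%R _) ( *:%R : K -> V -> V).
Proof.
split=> [u'|u] a x y /=; first by rewrite scalerDl scalerA.
by rewrite scalerDr !scalerA mulrC.
Qed.

(* The differential of a scaling of a vector function by a scalar function is
   read off that of the bilinear map [*:%R]. *)
HB.instance Definition _ (K : numFieldType) (V : normedModType K) :=
  bilinear_isBilinear.Build K K V V _ _ ( *:%R : K -> V -> V)
    (@scaler_is_bilinear K V).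

Lemma is_diff_scale (K : numFieldType) (U V : normedModType K)
    (s ds : U -> K) (f df : U -> V) (x : U) :
  is_diff x s ds -> is_diff x f df ->
  is_diff x (fun y => s y *: f y) (fun y => s x *: df y + ds y *: f x).
Proof.
move=> dsx dfx; pose B : {bilinear K -> V -> V} := *:%R.
have Bc : continuous (fun p : K * V => B p.1 p.2) by exact: scale_continuous.
have dB p : is_diff p (fun q => B q.1 q.2) (fun q => B p.1 q.2 + B q.1 p.2).
  by apply: DiffDef; [exact: differentiable_bilin|exact: diff_bilin].
exact: (is_diff_comp (is_diff_pair dsx dfx) (dB _)).
Qed.

(** * Maps of class C^k *)

Section Ck.
Variables (R : realType) (n : nat).
Let V := 'rV[R]_n.
Implicit Types (U : set V) (f g : V -> V).

(** Derivatives of maps of class C^k are known by formulas valid on [U] only;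
    as [U] is open, such a formula determines all further derivatives. *)
Lemma Ck_congr k U f g : open U -> {in U, f =1 g} -> Ck_on k U f -> Ck_on k U g.
Proof.
move=> Uo.
have fg_near f1 g1 (fg : {in U, f1 =1 g1}) x : U x -> \near x, f1 x = g1 x.
  move=> Ux; apply: filterS (open_nbhs_nbhs (conj Uo Ux)) => y Uy.
  by apply: fg; rewrite inE.
elim: k f g => [|k IH] f g fg.
  move=> cf x Ux; suff: g @ x --> f x by rewrite fg ?inE.
  have gf : \near x, f x = g x by exact: fg_near.
  exact: cvg_trans (near_eq_cvg gf) (cf x Ux).
case=> df Df; split=> [x Ux|v].
  exact: near_eq_differentiable (fg_near f g fg x Ux) (df x Ux).
apply: IH (Df v) => x; rewrite inE => Ux.
exact: near_eq_derive (fg_near f g fg x Ux).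
Qed.

Lemma CkW k U f : Ck_on k.+1 U f -> Ck_on k U f.
Proof.
elim: k f => [|k IH] f [df Df].
  by move=> x Ux; exact/differentiable_continuous/df.
by split=> // v; exact: IH (Df v).
Qed.

Lemma CkS k U U' f : U `<=` U' -> Ck_on k U' f -> Ck_on k U f.
Proof.
move=> UU'; elim: k f => [|k IH] f /=; first by move=> cf x /UU'; exact: cf.
by case=> df Df; split=> [x /UU'|v]; [exact: df|exact: IH].
Qed.

Lemma Ck_cst k U (a : V) : Ck_on k U (cst a).
Proof.
elim: k a => [|k IH] a; first by move=> x _; exact: cst_continuous.
split=> [x _|v]; first exact: differentiable_cst.
rewrite (_ : (fun x => _) = cst 0); first exact: IH.
by apply/funext => x; rewrite derive_cst.
Qed.

Lemma CkD k U f g : open U ->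
  Ck_on k U f -> Ck_on k U g -> Ck_on k U (fun x => f x + g x).
Proof.
move=> Uo; elim: k f g => [|k IH] f g.
  by move=> cf cg x Ux; apply: continuousD; [exact: cf|exact: cg].
move=> [df Df] [dg Dg]; split=> [x Ux|v].
  by apply: differentiableD; [exact: df|exact: dg].
apply: Ck_congr (IH _ _ (Df v) (Dg v)) => // x; rewrite inE => Ux.
by rewrite -deriveD //; apply: diff_derivable; [exact: df|exact: dg].
Qed.

Lemma Ck_sum k U (I : Type) (r : seq I) (h : I -> V -> V) : open U ->
  (forall i, Ck_on k U (h i)) -> Ck_on k U (fun x => \sum_(i <- r) h i x).
Proof.
move=> Uo Ch; elim: r => [|i r IH].
  by under eq_fun do rewrite big_nil; exact: Ck_cst.
by under eq_fun do rewrite big_cons; apply: CkD.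
Qed.

(** Scalar functions are represented as coordinates of maps [V -> V], which
    keeps the whole induction on [k] within such maps. *)
Lemma derive_coordZ (f g : V -> V) (i : 'I_n) (x : V) :
  differentiable f x -> differentiable g x ->
  differentiable (fun y => f y 0 i *: g y) x /\
  forall v, 'D_v (fun y => f y 0 i *: g y) x =
    f x 0 i *: 'D_v g x + 'D_v f x 0 i *: g x.
Proof.
move=> df dg; pose c (M : V) : R := M 0 i.
have c_lin : linear c by move=> a u v; rewrite /c !mxE.
pose cM := GRing.isLinear.Build _ _ _ _ _ c_lin.
pose cL : {linear V -> R} := HB.pack c cM.
have dc : is_diff (f x) c c.
  apply: DiffDef; first exact: differentiable_coord.
  exact: (@diff_lin _ _ _ cL _ (@coord_continuous _ _ _ _ _)).
have [dfg dfgE] := is_diff_scale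
  (is_diff_comp (differentiableP df) dc) (differentiableP dg).
by split=> // v; rewrite deriveE // dfgE /= !deriveE.
Qed.

(** The Leibniz rule expresses the derivative by products of the same shape
    with one factor differentiated, so that induction on [k] applies. *)
Lemma Ck_coordZ k U (i : 'I_n) f g : open U ->
  Ck_on k U f -> Ck_on k U g -> Ck_on k U (fun x => f x 0 i *: g x).
Proof.
move=> Uo; elim: k f g => [|k IH] f g.
  move=> cf cg x Ux; have cfi : {for x, continuous (fun y => f y 0 i)}.
    exact: (continuous_comp (cf x Ux) (@coord_continuous _ _ _ 0 i (f x))).
  exact: (cvgZ cfi (cg x Ux)).
move=> Cf Cg; have [df Df] := Cf; have [dg Dg] := Cg.
have dfg x (Ux : U x) := derive_coordZ i (df x Ux) (dg x Ux).
split=> [x /dfg[]//|v].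
apply: Ck_congr (CkD Uo (IH _ _ (CkW Cf) (Dg v)) (IH _ _ (Df v) (CkW Cg))) => //.
by move=> x; rewrite inE => /dfg[_ ->].
Qed.

(** The chain rule uses the directional derivative of [g] along the varying
    vector ['D_v f x]; expanding it in the standard basis leaves derivatives of
    [g] in fixed directions, the only ones that [Ck_on] speaks of. *)
Lemma derive_comp_coord (f g : V -> V) (x v : V) :
  differentiable f x -> differentiable g (f x) ->
  'D_v (g \o f) x = \sum_(i < n) 'D_v f x 0 i *: 'D_('e_i) g (f x).
Proof.
move=> df dg.
have dgE w : 'd g (f x) w = \sum_(i < n) w 0 i *: 'D_('e_i) g (f x).
  rewrite {1}[w]row_sum_delta linear_sum; apply: eq_bigr => i _.
  by rewrite linearZ /= (deriveE _ dg).
rewrite deriveE; last exact: differentiable_comp.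
by rewrite (diff_comp df dg) [LHS]/= dgE (deriveE v df).
Qed.

(** By [derive_comp_coord], a derivative of [g \o f] is a sum of products of
    coordinates of a derivative of [f] with compositions [D_(e_i) g \o f], to
    which the induction hypothesis applies. *)
Lemma Ck_comp k (U W : set V) f g : open U -> (forall x, U x -> W (f x)) ->
  Ck_on k U f -> Ck_on k W g -> Ck_on k U (g \o f).
Proof.
move=> Uo UW; elim: k f g UW => [|k IH] f g UW.
  move=> cf cg x Ux; apply: continuous_comp; first exact: cf.
  exact/cg/UW.
move=> Cf [dg Dg]; have [df Df] := Cf; split=> [x Ux|v].
  by apply: differentiable_comp; [exact: df|exact/dg/UW].
apply: Ck_congr (Ck_sum _ _ (fun i => Ck_coordZ i Uo (Df v)
  (IH _ _ UW (CkW Cf) (Dg 'e_i)))) => // x; rewrite inE => Ux.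
by rewrite derive_comp_coord //; [exact: df|exact/dg/UW].
Qed.

End Ck.

(** * Composition of partially defined smooth maps *)

Section PartialMaps.
Variables (R : realType) (n : nat).
Let V := 'rV[R]_n.

(** Bare partial maps are composed here because both a composite of partial
    bijections and its inverse are, by conversion, of this form. *)
Definition pcomp (g f : V -> option V) : V -> option V := fun x => obind g (f x).

Lemma pdom_pcomp (g f : V -> option V) :
  pdom (pcomp g f) = pdom f `&` ptotal f @^-1` pdom g.
Proof.
apply/funext => x; apply/propext; rewrite /setI /preimage /pdom /pcomp /ptotal /=.
by case: (f x) => [y|]; split=> // -[].
Qed.

Lemma open_pdom_pcomp (g f : V -> option V) : open (pdom f) -> open (pdom g) ->
  Ck_on 0 (pdom f) (ptotal f) -> open (pdom (pcomp g f)).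
Proof.
move=> fo go cf; rewrite pdom_pcomp openE => x [fx gfx]; apply: filterI.
  exact: open_nbhs_nbhs.
by apply: (cf x fx); exact: open_nbhs_nbhs.
Qed.

Lemma smooth_pcomp (g f : V -> option V) : open (pdom f) -> open (pdom g) ->
  smooth f -> smooth g -> smooth (pcomp g f).
Proof.
move=> fo go sf sg k; have o := open_pdom_pcomp fo go (sf 0).
apply: (@Ck_congr _ _ _ _ (ptotal g \o ptotal f)) => //.
  move=> x; rewrite inE /pdom /pcomp /ptotal /=.
  by case: (f x).
apply: Ck_comp (sg k) => //.
  by move=> x; rewrite pdom_pcomp => -[].
by apply: CkS (sf k); rewrite pdom_pcomp; exact: subIsetl.
Qed.

End PartialMaps.

(** * Orbits and fixed points of partial bijections *)

Section OrbitsOfPartialBijections.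
Variable V : Type.
Implicit Types (f p psi : pbij V) (x y z : V).

Lemma pbij_inj f x y z : f x = Some z -> f y = Some z -> x = y.
Proof. by move=> /pinvP fx /pinvP; rewrite fx => -[]. Qed.

Lemma pbpowD f (a b : nat) x :
  pbpow f (a + b)%N x = obind (pbpow f a) (pbpow f b x).
Proof.
elim: a => [|a IH]; first by case: (pbpow f b x).
rewrite addSn [LHS]/= -/(pbpow f (a + b)%N x) IH.
by case: (pbpow f b x).
Qed.

Lemma pbpow_mul f (m q : nat) x :
  pbpow f m x = Some x -> pbpow f (q * m)%N x = Some x.
Proof.
by move=> fm; elim: q => [|q IH] //; rewrite mulSn pbpowD IH.
Qed.

(** The return times of [x] are the multiples of the smallest one, by
    Euclidean division. *)
Lemma periodic_orbit_dvdP f x (N : nat) : (0 < N)%N ->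
  periodic_orbit_dvd f x N <-> pbpow f N x = Some x.
Proof.
move=> N0; split=> [[m [_ fm _] /dvdnP[q ->]]|fN]; first exact: pbpow_mul.
have [|m /andP[m0 /asboolP fm] m_min] :=
    @ex_minnP (fun m => (0 < m)%N && `[< pbpow f m x = Some x >]).
  by exists N; rewrite N0; apply/asboolP.
exists m; first by split=> // j j0 fj; apply: m_min; rewrite j0; apply/asboolP.
have fr : pbpow f (N %% m)%N x = Some x.
  by rewrite -fN {2}(divn_eq N m) addnC pbpowD (pbpow_mul _ fm).
have [r0|r0] := posnP (N %% m)%N; first by rewrite /dvdn r0.
have : (m <= N %% m)%N by apply: m_min; rewrite r0; apply/asboolP.
by rewrite leqNgt ltn_mod m0.
Qed.

(** Applying [f] once more replaces the exponent [k - 2], which is negative for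
    [k = 1], by a natural number. *)
Lemma pbpow_sub2 f (k : nat) x y w : (0 < k)%N -> f y = Some w ->
  pbpow f (k%:Z - 2) x = Some y <-> pbpow f k.-1 x = Some w.
Proof.
case: k => [//|[|k]] _ fy.
  have -> : (1%:Z - 2 = Negz 0)%R by [].
  rewrite /=; split=> [/pinvP|[->]]; last exact/pinvP.
  by rewrite fy.
have -> : (k.+2%:Z - 2 = k)%R by rewrite -addn2 PoszD addrK.
rewrite [pbpow f k.+2.-1 x]/= -/(pbpow f k x); split=> [->//|].
by case: (pbpow f k x) => //= z fz; rewrite (pbij_inj fz fy).
Qed.

Lemma pbpow_sub1 f (k : nat) : (0 < k)%N -> pbpow f (k%:Z - 1) = pbpow f k.-1.
Proof. by case: k => // k _; rewrite -addn1 PoszD addrK addn1. Qed.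

(** The point [y] records that [w] is in the image of [f], which [f^(k-1) x = w]
    does not imply when [k = 1]. *)
Lemma Fixp_phiP p f (k : nat) x : (0 < k)%N ->
  Fixp (pbcomp (pbcomp p f) (pbpow f (k%:Z - 2))) x <->
  exists y w, [/\ f y = Some w, pbpow f k.-1 x = Some w & p w = Some x].
Proof.
move=> k0; rewrite /Fixp /=; split=> [|[y [w [fy fk pw]]]].
  case fk: (pbpow _ _ x) => [y|] //=; case fy: (f y) => [w|] //= pw.
  by exists y, w; split=> //; apply/(pbpow_sub2 _ k0 fy).
by have /(pbpow_sub2 _ k0 fy) -> := fk; rewrite /= fy.
Qed.

Lemma Fixp_phi'P p f (k : nat) x : (0 < k)%N ->
  Fixp (pbcomp (pbpow f (k%:Z - 1)) p) x <->
  exists2 y, p x = Some y & pbpow f k.-1 y = Some x.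
Proof.
move=> k0; rewrite /Fixp /= (pbpow_sub1 _ k0).
by case: (p x) => [y|]; split=> [fy|[z [->]]] //; exists y.
Qed.

(** The three ways in which cancelling a power of [f] produces a return to [x]
    serve (A), (B) and (C) respectively. Injectivity of the powers is what
    replaces invertibility when the maps are only partially defined. *)
Lemma pbpow_fix_iff_image f (a b : nat) x w : pbpow f a x = Some w ->
  pbpow f b x = Some x <-> pbpow f (a + b)%N x = Some w.
Proof.
move=> fa; rewrite pbpowD; split=> [->//|].
by case: (pbpow f b x) => //= u fu; rewrite (pbij_inj fu fa).
Qed.

Lemma pbpow_fix_iff_preimage f (a b : nat) x y : pbpow f a y = Some x ->
  pbpow f b x = Some x <-> pbpow f (b + a)%N y = Some x.
Proof. by move=> fa; rewrite pbpowD fa. Qed.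

Lemma pbpow_return_iff f (a b : nat) x y : pbpow f a y = Some x ->
  pbpow f (a + b)%N x = Some x <-> pbpow f b x = Some y.
Proof.
move=> fa; rewrite pbpowD; split=> [|->//].
by case: (pbpow f b x) => //= u fu; rewrite (pbij_inj fu fa).
Qed.

(** Each passage of [f] through [psi] undoes one step of the orbit, so that
    [f^j (psi (f^j x))] is independent of [j], hence equal to [psi x = x]. *)
Lemma Fixp_reversor_orbit psi f (W : set V) x (l : nat) :
  (forall z, W z -> obind f (psi z) = obind psi (Defs.pinv f z)) ->
  (forall j, (j <= l)%N -> exists2 z, pbpow f j x = Some z & W z) ->
  Fixp psi x -> (exists2 y, pbpow f l x = Some y & Fixp psi y) ->
  pbpow f (l + l)%N x = Some x.
Proof.
move=> rev orb psix [y fl psiy].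
suff /(_ l (leqnn l)) : forall j, (j <= l)%N ->
    obind (pbpow f j) (obind psi (pbpow f j x)) = Some x.
  by rewrite fl /= psiy /= pbpowD fl.
elim=> [_|j IH jl]; first by rewrite /= psix.
have [z fz Wz] := orb j.+1 jl; have [u fu Wu] := orb j (ltnW jl).
have fuz : f u = Some z by rewrite -fz /= -/(pbpow f j x) fu.
have powSr v : pbpow f j.+1 v = obind (pbpow f j) (f v) by rewrite -addn1 pbpowD.
have -> : obind (pbpow f j.+1) (obind psi (pbpow f j.+1 x)) =
    obind (pbpow f j) (obind f (psi z)).
  by rewrite fz /=; case: (psi z) => //= v; rewrite -powSr.
by rewrite rev // (pinvP f u z).1 //= -(IH (ltnW jl)) fu.
Qed.

End OrbitsOfPartialBijections.

(** * The involution [phi2] *)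

Section LocalDiffeomorphisms.
Variables (R : realType) (n : nat).
Let V := 'rV[R]_n.
Implicit Types f g F phi : pbij V.

Lemma local_diffeo_pbcomp f g :
  local_diffeo f -> local_diffeo g -> local_diffeo (pbcomp f g).
Proof.
move=> [f0 [fo fio] sf sfi] [g0 [go gio] sg sgi]; split.
- by rewrite /= g0.
- split; first exact: open_pdom_pcomp (sg 0).
  exact: open_pdom_pcomp (sfi 0).
- exact: smooth_pcomp.
- exact: smooth_pcomp.
Qed.

Lemma local_diffeo_near f (P : set V) : local_diffeo f ->
  (\forall y \near (0 : V), P y) ->
  \forall x \near (0 : V), exists2 y, f x = Some y & P y.
Proof.
move=> [f0 [fo _] sf _] P0.
have d0 : pdom f 0 by rewrite /pdom /= f0.
have ptotal0 : ptotal f 0 = 0 by rewrite /ptotal f0.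
have fP : \forall x \near (0 : V), P (ptotal f x).
  by apply: (sf 0%N 0 d0); rewrite ptotal0.
apply: filterS2 fP (open_nbhs_nbhs (conj fo d0)) => x.
by rewrite /= /ptotal /pdom /=; case: (f x) => // y Py _; exists y.
Qed.

(** With [y = F x], reversibility at [y] gives [F (phi y) = phi (F^-1 y) = phi x],
    whence [phi (F (phi (F x))) = phi (phi x) = x]. *)
Lemma involution_pbcomp phi F : involution phi -> local_diffeo F ->
  reversing_symmetry phi F -> involution (pbcomp phi F).
Proof.
move=> [dphi phiphi] dF [_ rev]; split; first exact: local_diffeo_pbcomp.
rewrite /germ_eq; near=> x.
have [y Fx revy] : exists2 y, F x = Some y &
    obind F (phi y) = obind phi (Defs.pinv F y).
  by near: x; exact: local_diffeo_near.
have phix : obind phi (phi x) = Some x by near: x.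
rewrite /= Fx /=; case: (phi y) revy => [z|] /=.
  by rewrite (pinvP F x y).1 //= => ->.
by rewrite (pinvP F x y).1 //= => E; move: phix; rewrite -E.
Unshelve. all: by end_near. Qed.

Lemma germ_factor phi F : involution phi -> local_diffeo F ->
  germ_eq F (pbcomp phi (pbcomp phi F)).
Proof.
move=> [_ phiphi] dF; apply: filterS (local_diffeo_near dF phiphi) => x.
by case=> y /= -> /= ->.
Qed.

End LocalDiffeomorphisms.

Theorem proposition2p12 (R : realType) (n : nat) (phi1 F : pbij 'rV[R]_n)
    (phi1_inv : involution phi1) (F_diffeo : local_diffeo F)
    (F_rev : reversing_symmetry phi1 F) :
  let phi2 := pbcomp phi1 F in
  let phi (k : nat) := pbcomp phi2 (pbpow F (k%:Z - 2)) in
  let phi' (k : nat) := pbcomp (pbpow F (k%:Z - 1)) phi1 in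
  [/\ involution phi2 /\ germ_eq F (pbcomp phi1 phi2),
      (forall psi : pbij 'rV[R]_n, reversing_symmetry psi F ->
        exists2 W : set 'rV[R]_n, nbhs (0 : 'rV[R]_n) W &
        forall (x : 'rV[R]_n) (l : nat), (1 <= l)%N ->
          (forall j : nat, (j <= l)%N ->
            exists2 z, pbpow F j x = Some z & W z) ->
          Fixp psi x ->
          (exists2 y, pbpow F l x = Some y & Fixp psi y) ->
          periodic_orbit F x) &
      exists2 W : set 'rV[R]_n, nbhs (0 : 'rV[R]_n) W &
      forall (x : 'rV[R]_n) (k l : nat), W x -> (1 <= k)%N -> (k < l)%N ->
      [/\ (* (A) *)
          (Fixp (phi k) x -> Fixp (phi l) x -> periodic_orbit_dvd F x (l - k)) /\
          (periodic_orbit_dvd F x (l - k) -> Fixp (phi k) x -> Fixp (phi l) x),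
          (* (B) *)
          (Fixp (phi' k) x -> Fixp (phi' l) x -> periodic_orbit_dvd F x (l - k)) /\
          (periodic_orbit_dvd F x (l - k) -> Fixp (phi' k) x -> Fixp (phi' l) x) &
          (* (C) *)
          (Fixp (phi' k) x -> Fixp (phi l) x ->
             periodic_orbit_dvd F x (k + l - 2)) /\
          (periodic_orbit_dvd F x (k + l - 2) -> Fixp (phi' k) x ->
             Fixp (phi l) x)]].
Proof.
move=> phi2 phi phi'; have [_ phi1K] := phi1_inv; split.
- by split; [exact: involution_pbcomp|exact: germ_factor].
- move=> psi [_ rev].
  exists [set z | obind F (psi z) = obind psi (Defs.pinv F z)] => //.
  move=> x l l1 orb psix psiy; exists (l + l)%N; split.
    by rewrite addn_gt0 l1.
  exact: Fixp_reversor_orbit orb psix psiy.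
exists [set x | obind phi1 (phi1 x) = Some x] => // x k l Wx k1 kl.
have l1 : (0 < l)%N by exact: ltn_trans kl.
have lk : (0 < l - k)%N by rewrite subn_gt0.
have kl2 : (0 < k + l - 2)%N by lia.
have eA : (l.-1 = k.-1 + (l - k))%N by lia.
have eC : (k + l - 2 = k.-1 + l.-1)%N by lia.
split; split.
- move=> /Fixp_phiP-/(_ k1)[y [w [_ fk pw]]].
  move=> /Fixp_phiP-/(_ l1)[y' [w' [_ fl pw']]].
  apply/periodic_orbit_dvdP => //; apply/(pbpow_fix_iff_image _ fk).
  by rewrite -eA fl (pbij_inj pw' pw).
- move=> /(periodic_orbit_dvdP _ _ lk) per.
  move=> /Fixp_phiP-/(_ k1)[y [w [fy fk pw]]].
  apply/Fixp_phiP => //; exists y, w; split=> //.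
  by rewrite eA; apply/(pbpow_fix_iff_image _ fk).
- move=> /Fixp_phi'P-/(_ k1)[y py fk] /Fixp_phi'P-/(_ l1)[y' py' fl].
  apply/periodic_orbit_dvdP => //; apply/(pbpow_fix_iff_preimage _ fk).
  by rewrite addnC -eA; move: py' fl; rewrite py => -[->].
- move=> /(periodic_orbit_dvdP _ _ lk) per /Fixp_phi'P-/(_ k1)[y py fk].
  apply/Fixp_phi'P => //; exists y => //.
  by rewrite eA addnC; apply/(pbpow_fix_iff_preimage _ fk).
- move=> /Fixp_phi'P-/(_ k1)[y py fk] /Fixp_phiP-/(_ l1)[_ [w [_ fl pw]]].
  apply/periodic_orbit_dvdP => //; rewrite eC; apply/(pbpow_return_iff _ fk).
  move: Wx; rewrite /= py /= => py'; rewrite fl.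
  by rewrite (pbij_inj pw py').
- move=> /(periodic_orbit_dvdP _ _ kl2) per /Fixp_phi'P-/(_ k1)[y py fk].
  have fl : pbpow F l.-1 x = Some y by apply/(pbpow_return_iff _ fk); rewrite -eC.
  (* [F^(l-1) x] is in the image of [F] because [l] is at least 2. *)
  have [u fu] : exists u, F u = Some y.
    move: fl; have -> : l.-1 = (1 + l.-2)%N by lia.
    by rewrite pbpowD; case: (pbpow F l.-2 x) => //= u; exists u.
  apply/Fixp_phiP => //; exists u, y; split=> //.
  by move: Wx; rewrite /= py.
Qed.
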